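(* Let $d \ge 1$ be an integer, let $\mathbf{r}, \mathbf{n} \in \mathbb{Z}_{\ge 0}^d$ be integer vectors, and let $\mathcal{S} \subseteq \mathbb{Z}_{\ge 0}^d$ be a non-empty finite family of integer vectors. Suppose that for all $\mathbf{s} \in \mathcal{S}$ and all $i \in [d]$ we have $n_i \ge r_i \ge s_i$. Define $$\downarrow \mathcal{S} := \{\mathbf{m} \in \mathbb{Z}_{\ge 0}^d \mid \exists \mathbf{s} \in \mathcal{S}\ \forall i \in [d]\ \ m_i \le s_i\}.$$ Then $$\mathrm{c\text{-}wsat}(K^{\mathcal{S}}_{\mathbf{n}}, K^{\mathcal{S}}_{\mathbf{r}}) = \sum_{\mathbf{s} \in \mathcal{S}} \prod_{i \in [d]} \binom{n_i}{s_i} - \sum_{\mathbf{m} \in \downarrow \mathcal{S}}\ \prod_{\substack{1\le i\le d \\ m_i \ne 0}} \binom{m_i - 1 + n_i - r_i}{m_i}.$$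
   Context: Notation: for an integer $n\ge 1$, $[n]=\{1,\dots,n\}$, and $[n]=\emptyset$ for $n\le 0$. A hypergraph $G$ has a finite vertex set $V(G)$ and an edge set $E(G)$ which is a set of subsets of $V(G)$ (not necessarily uniform). For $\mathbf{r}\in\mathbb{Z}_{\ge0}^d$ and a non-empty finite family $\mathcal{S}\subseteq\mathbb{Z}_{\ge0}^d$, the hypergraph $K^{\mathcal{S}}_{\mathbf{r}}$ has vertex set $\bigcup_{i\in[d]}[r_i]\times\{i\}$, and its edges are exactly the vertex subsets $W$ for which there is $\mathbf{s}\in\mathcal{S}$ with $|W\cap([r_i]\times\{i\})|=s_i$ for all $i\in[d]$. It is viewed as a $d$-colored hypergraph with the coloring giving every vertex of $[r_i]\times\{i\}$ the color $i$. A $d$-colored hypergraph is a pair $(G,c)$ with $G$ a hypergraph and $c:V(G)\to[d]$ an arbitrary map. A colored copy of $(H,t)$ in $(G,c)$ is a subhypergraph $\widetilde H\subseteq G$ ($V(\widetilde H)\subseteq V(G)$, $E(\widetilde H)\subseteq E(G)$) with coloring $c|_{V(\widetilde H)}$ such that there is a bijection $f:V(\widetilde H)\to V(H)$ with $S\in E(\widetilde H)\iff f(S)\in E(H)$ for all $S\subseteq V(\widetilde H)$ and $c(v)=t(f(v))$ for all $v\in V(\widetilde H)$. Given $d$-colored hypergraphs $(G,c)$ and $(H,t)$, a spanning subhypergraph $F$ of $G$ ($V(F)=V(G)$, $E(F)\subseteq E(G)$, with the same coloring $c$) is weakly saturated if there is an ordering $e_1,\dots,e_k$ of the edges in $E(G)\setminus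 E(F)$ such that each $e_i$ belongs to a colored copy of $(H,t)$ in $(F\cup\{e_1,\dots,e_i\},c)$. The colored weak saturation number $\mathrm{c\text{-}wsat}((G,c),(H,t))$ is the minimum number of edges of such an $F$. An empty product equals $1$. *)

(* Defs.v *)
From mathcomp Require Import all_boot.
From mathcomp Require Import finmap boolp.

Set Implicit Arguments.
Unset Strict Implicit.
Unset Printing Implicit Defensive.

Local Open Scope fset_scope.

(* A hypergraph whose vertex set is the whole finite type T is given by its
   set of edges G : {set {set T}}; its spanning subhypergraphs are then the
   subsets F \subset G.  A d-coloring is an arbitrary map c : T -> 'I_d. *)
Section ColoredWeakSaturation.
Variables (d : nat) (T U : finType).

(* The subhypergraph (W, E) of G, colored by the restriction of c, is a colored
   copy of (H, t).  The bijection has the subtype of vertices in W as domain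
   (and not T) so that copies of the hypergraph without vertices are allowed
   even when T is inhabited; subsets of W are the val @: S. *)
Definition colored_copy (G : {set {set T}}) (c : T -> 'I_d)
    (H : {set {set U}}) (t : U -> 'I_d) (W : {set T}) (E : {set {set T}}) :
    Prop :=
  [/\ E \subset G,
      forall e : {set T}, e \in E -> e \subset W
    & exists f : {x : T | x \in W} -> U,
        [/\ bijective f,
            forall S : {set {x : T | x \in W}},
              ([set val x | x in S] \in E) = (f @: S \in H)
          & forall x : {x : T | x \in W}, c (val x) = t (f x)]].

Definition weakly_saturated (G : {set {set T}}) (c : T -> 'I_d)
    (H : {set {set U}}) (t : U -> 'I_d) (F : {set {set T}}) : Prop :=
  F \subset G /\
  exists es : seq {set T},
    [/\ uniq es,
        es =i G :\: F
      & forall i : nat, i < size es ->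
          exists (W : {set T}) (E : {set {set T}}),
            colored_copy (F :|: [set:: take i.+1 es]) c H t W E /\
            nth set0 es i \in E].

(* The minimum ranges over a nonempty set, as F = G is weakly saturated. *)
Definition cwsat (G : {set {set T}}) (c : T -> 'I_d)
    (H : {set {set U}}) (t : U -> 'I_d) : nat :=
  #|[arg min_(F < G | `[< weakly_saturated G c H t F >]) #|F| ]|.

Lemma weakly_saturated_refl (G : {set {set T}}) (c : T -> 'I_d)
    (H : {set {set U}}) (t : U -> 'I_d) : weakly_saturated G c H t G.
Proof.
by split=> //; exists [::]; split=> // e; rewrite setDv !inE.
Qed.

Lemma cwsatP (G : {set {set T}}) (c : T -> 'I_d)
    (H : {set {set U}}) (t : U -> 'I_d) :
  (exists2 F, weakly_saturated G c H t F & #|F| = cwsat G c H t) /\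
  (forall F, weakly_saturated G c H t F -> cwsat G c H t <= #|F|).
Proof.
rewrite /cwsat; case: arg_minnP => [|F /asboolP satF minF].
  exact/asboolP/weakly_saturated_refl.
by split=> [|F' /asboolP /minF //]; exists F.
Qed.

End ColoredWeakSaturation.

Section CompleteHypergraph.
Variable d : nat.

(* The vertex Tagged _ j with tag i stands for the pair (j, i) in
   [r_i] x {i}; indices and vertices are numbered from 0. *)
Definition Kvertex (r : {ffun 'I_d -> nat}) : finType :=
  {i : 'I_d & 'I_(r i)}.

Definition Kcolor (r : {ffun 'I_d -> nat}) (v : Kvertex r) : 'I_d := tag v.

Definition K (S : {fset {ffun 'I_d -> nat}}) (r : {ffun 'I_d -> nat}) :
    {set {set Kvertex r}} :=
  [set W : {set Kvertex r} |
    [exists s : S, [forall i : 'I_d,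
      #|W :&: [set v | tag v == i]| == fsval s i]]].

Definition downset (S : {fset {ffun 'I_d -> nat}}) :
    {fset {ffun 'I_d -> nat}} :=
  \bigcup_(s <- S)
    [fset [ffun i => (u i : nat)]
      | u : {dffun forall i : 'I_d, 'I_(s i).+1} in
          {: {dffun forall i : 'I_d, 'I_(s i).+1}}].

Lemma downsetP (S : {fset {ffun 'I_d -> nat}}) (m : {ffun 'I_d -> nat}) :
  m \in downset S <-> exists2 s, s \in S & forall i, m i <= s i.
Proof.
split.
  case/bigfcupP=> s /andP[sS _] /imfsetP[u _ ->]; exists s => // i.
  by rewrite ffunE -ltnS.
case=> s sS le_ms; apply/bigfcupP; exists s; first by rewrite sS.
apply/imfsetP; exists [ffun i => inord (m i) : 'I_(s i).+1] => //=.
by apply/ffunP=> i; rewrite !ffunE inordK ?ltnS.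
Qed.

End CompleteHypergraph.

(* Main.v *)
Require Import Defs.
From mathcomp Require Import all_boot all_order all_algebra.
From mathcomp Require Import finmap zify.

(* Write N = n - r and give the vertex (j, i) the coordinate x = j.

   Lower bound.  A copy on the vertex set W yields the function
   e |-> prod_(u in e) P_(W, tag u)(x_u), where P_(W, i) is the monic polynomial of
   degree N_i whose roots are the coordinates of the vertices of color i outside W.
   It vanishes at e unless e is contained in W.  Evaluating these functions for the
   copies used at each step on the successively added edges gives a triangular
   matrix with nonzero diagonal.  Expanded in the nonleading coefficients of the
   P_(W, i), the functions are combinations of monomials of degree m_i in the N_i
   coefficients of color i, for m in the down-set of S, so the number of added
   edges is at most the number of these monomials.

   Upper bound.  For a vertex set A of color type m in the down-set, all of whose
   vertices of color i have index > r_i - m_i, choose s in S above m and leave out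
   the edge A + {r_i - s_i <= index < r_i - m_i}.  It is restored in the order of
   increasing #|A|, by the copy on A + {index < r_i - m_i}: that copy contains the
   edge left out for another set B only if #|B| < #|A|. *)

Set Implicit Arguments.
Unset Strict Implicit.
Unset Printing Implicit Defensive.

(** * Counting sets and exponent vectors by color *)

Lemma card_preim_seq_in (T : finType) (K : eqType) (P : pred T) (h : T -> K) (D : seq K) :
  uniq D ->
  #|[set x | (h x \in D) && P x]| = \sum_(m <- D) #|[set x | (h x == m) && P x]|.
Proof.
elim: D => [|m D IH] /=; first by rewrite big_nil eq_card0 // => x; rewrite !inE.
case/andP=> mD uD; rewrite big_cons -IH // -cardsUI.
rewrite [X in _ = _ + X]eq_card0 ?addn0 => [|x].
  by apply: eq_card => x; rewrite !inE -andb_orl.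
by rewrite !inE; apply/andP=> -[/andP[/eqP-> _]]; rewrite (negPf mD).
Qed.

Lemma card_preim_seq (T : finType) (K : eqType) (h : T -> K) (D : seq K) :
  uniq D -> #|[set x | h x \in D]| = \sum_(m <- D) #|[set x | h x == m]|.
Proof.
move=> /(card_preim_seq_in predT h) eqD.
transitivity #|[set x | (h x \in D) && predT x]|.
  by apply: eq_card => x; rewrite !inE andbT.
by rewrite eqD; apply: eq_bigr => m _; apply: eq_card => x; rewrite !inE andbT.
Qed.

Lemma card_family_prod (I T : finType) (F : I -> {set T}) :
  #|(family F : {pred {ffun I -> T}})| = \prod_i #|F i|.
Proof. by rewrite card_family foldrE big_map -big_enum. Qed.

(** A set is the union of its color classes, and these are chosen independently of each other. *)
Lemma card_sets_by_fiber (T I : finType) (c : T -> I) (B : {set T}) (m : I -> nat) :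
  #|[set A : {set T} | (A \subset B) && [forall i, #|A :&: [set x | c x == i]| == m i]]|
  = \prod_i 'C(#|B :&: [set x | c x == i]|, m i).
Proof.
pose F i := [set A : {set T} | A \subset B :&: [set x | c x == i] & #|A| == m i].
rewrite (eq_bigr (fun i => #|F i|)) => [|i _]; last by rewrite cards_draws.
rewrite -card_family_prod.
pose g (A : {set T}) := [ffun i => A :&: [set x | c x == i]].
rewrite -(card_imset _ (f := g)); last first.
  move=> A A' /ffunP eqA; apply/setP=> x.
  by have /setP/(_ x) := eqA (c x); rewrite !ffunE !inE eqxx !andbT.
apply: eq_card => f; apply/imsetP/familyP => [[A] | famf].
  rewrite inE => /andP[sAB /forallP mA] -> i; rewrite ffunE inE mA andbT.
  exact: setSI.
have cf i x : x \in f i -> (x \in B) && (c x == i).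
  have := famf i; rewrite inE => /andP[/subsetP sf _] /sf.
  by rewrite !inE.
have fE : f = g (\bigcup_i f i).
  apply/ffunP=> i; rewrite ffunE; apply/setP=> x; rewrite !inE.
  apply/idP/andP => [xf | [/bigcupP[j _ xf] /eqP <-]].
    by split; [apply/bigcupP; exists i | case/andP: (cf _ _ xf)].
  by case/andP: (cf _ _ xf) => _ /eqP->.
exists (\bigcup_i f i) => //; rewrite inE; apply/andP; split.
  by apply/bigcupsP=> i _; apply/subsetP=> x /cf/andP[].
apply/forallP=> i; have := famf i; rewrite inE => /andP[_].
by rewrite {1}fE ffunE.
Qed.

(** Stars and bars for monomials of degree [m] in the variables [X]. It is only an inequality
    because exponents are capped below [b]. For [m = 0] the truncated [m - 1] does no harm, as the
    binomial is 1. *)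
Lemma card_ffun_supp_sum (T : finType) (b : nat) (X : {set T}) (m : nat) :
  #|[set k : {ffun T -> 'I_b} | [forall x, (x \notin X) ==> (k x == 0 :> nat)]
      && (\sum_(x in X) k x == m)]| <= 'C(m - 1 + #|X|, m).
Proof.
set A := [set k | _].
have AP k : k \in A -> (forall x, x \notin X -> k x = 0 :> nat) /\ \sum_(x in X) k x = m.
  rewrite inE => /andP[/forallP k0 /eqP]; split=> // x xX.
  by have /implyP/(_ xX)/eqP := k0 x.
have le_km k : k \in A -> forall x, k x <= m.
  move=> /AP[k0 <-] x; have [xX|/k0-> //] := boolP (x \in X).
  by rewrite (bigD1 x) //= leq_addr.
case cX: #|X| => [|p].
  move/eqP: cX; rewrite cards_eq0 => /eqP X0; rewrite addn0.
  have [m0 | m0] := posnP m.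
    rewrite m0 bin0; apply/card_le1_eqP => k k' kA k'A; apply/ffunP=> x; apply: val_inj => /=.
    by have := le_km _ kA x; have := le_km _ k'A x; rewrite m0 !leqn0 => /eqP-> /eqP->.
  rewrite bin_small; last by lia.
  rewrite leqn0 cards_eq0; apply/eqP/setP=> k; rewrite [RHS]inE; apply/negP=> /AP[_].
  by rewrite X0 big_set0 => m0'; rewrite -m0' in m0.
(* With [p + 1] variables, [card_ord_partitions] counts the ordered sums by the complementary
   binomial; both sides are 1 at [m = 0]. *)
have -> : 'C(m - 1 + p.+1, m) = 'C(p + m, p).
  have [-> | m0] := posnP m; first by rewrite bin0 addn0 binn.
  by rewrite -(bin_sub (leq_addr m p)) addKn; congr 'C(_, _); lia.
rewrite -card_ord_partitions.
pose g (k : {ffun T -> 'I_b}) : p.+1.-tuple 'I_m.+1 :=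
  [tuple inord (k (enum_val (cast_ord (esym cX) j))) | j < p.+1].
rewrite -(card_in_imset (f := g) (D := A)).
  apply: subset_leq_card; apply/subsetP=> _ /imsetP[k kA ->]; rewrite inE.
  rewrite big_tuple; apply/eqP; transitivity (\sum_(x in X) k x); last exact: (AP _ kA).2.
  rewrite [RHS]big_enum_val [RHS](reindex (cast_ord (esym cX))) /=; last first.
    by exists (cast_ord cX) => j _; rewrite ?cast_ordK ?cast_ordKV.
  apply: eq_bigr => j _; rewrite tnth_mktuple inordK // ltnS.
  exact: le_km.
move=> k k' kA k'A eq_g; apply/ffunP=> x; apply: val_inj => /=.
have [xX|xX] := boolP (x \in X); last by rewrite (AP _ kA).1 // (AP _ k'A).1.
have := congr1 (fun t => tnth t (cast_ord cX (enum_rank_in xX x))) eq_g.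
rewrite !tnth_mktuple cast_ordK enum_rankK_in // => /(congr1 val) /=.
by rewrite !inordK // ltnS le_km.
Qed.

(** * Color types and the copies of [K S r] *)

Definition ctype {d : nat} {T : finType} (c : T -> 'I_d) (A : {set T}) : {ffun 'I_d -> nat} :=
  [ffun i => #|A :&: [set x | c x == i]|].

Lemma in_K (d : nat) (S : {fset {ffun 'I_d -> nat}}) (r : {ffun 'I_d -> nat})
    (A : {set Kvertex r}) : (A \in K S r) = (ctype (@Kcolor d r) A \in S).
Proof.
rewrite inE; apply/existsP/idP => [[s /forallP sA] | AS].
  suff -> : ctype (@Kcolor d r) A = fsval s by apply: fsvalP.
  by apply/ffunP=> i; rewrite ffunE; apply/eqP/sA.
by exists [` AS]%fset; apply/forallP=> i; rewrite /= ffunE.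
Qed.

Lemma ctype_imset (d : nat) (T U : finType) (c : T -> 'I_d) (t : U -> 'I_d)
    (f : T -> U) (A : {set T}) :
  injective f -> (forall x, c x = t (f x)) -> ctype t (f @: A) = ctype c A.
Proof.
move=> inj_f cf; apply/ffunP=> i; rewrite !ffunE -[RHS](card_imset _ inj_f).
apply: eq_card => y; rewrite !inE; apply/andP/imsetP => [[/imsetP[x xA ->] /eqP tx]|[x]].
  by exists x; rewrite // !inE xA cf tx eqxx.
by rewrite !inE => /andP[xA /eqP <-] ->; rewrite imset_f // cf.
Qed.

Lemma card_ctype (d : nat) (T : finType) (c : T -> 'I_d) (A : {set T}) :
  #|A| = \sum_i ctype c A i.
Proof.
rewrite -sum1_card (partition_big c predT) //=; apply: eq_bigr => i _.
by rewrite ffunE -sum1_card; apply: eq_bigl => x; rewrite !inE.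
Qed.

Lemma ctypeU (d : nat) (T : finType) (c : T -> 'I_d) (A B : {set T}) (i : 'I_d) :
  [disjoint A & B] -> ctype c (A :|: B) i = ctype c A i + ctype c B i.
Proof.
move=> dAB; rewrite !ffunE setIUl cardsU; set X := _ :&: _ :&: _.
suff -> : X = set0 by rewrite cards0 subn0.
apply/setP=> x; rewrite !inE; apply/negP=> /andP[/andP[xA _] /andP[xB _]].
by have /pred0P/(_ x) := dAB; rewrite /= xA xB.
Qed.

(** Each [x] goes to the element at the same position in the enumeration of the class of the same
    color. *)
Lemma color_preserving_bijection (d : nat) (T U : finType) (c : T -> 'I_d)
    (t : U -> 'I_d) :
  ctype c [set: T] = ctype t [set: U] ->
  exists f : T -> U, bijective f /\ forall x, c x = t (f x).
Proof.
move=> /ffunP eq_ct.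
pose X i := [set x | c x == i]; pose Y i := [set y | t y == i].
have eqXY i : #|X i| = #|Y i| by have := eq_ct i; rewrite !ffunE !setTI.
have /fin_all_exists[f fP] x :
    exists y, t y = c x /\ index y (enum (Y (c x))) = index x (enum (X (c x))).
  have lt_x : index x (enum (X (c x))) < size (enum (Y (c x))).
    by rewrite -cardE -eqXY cardE index_mem mem_enum inE.
  case E: (enum (Y (c x))) lt_x => [|y0 s] // lt_x.
  exists (nth y0 (enum (Y (c x))) (index x (enum (X (c x))))); split.
    have : nth y0 (enum (Y (c x))) (index x (enum (X (c x)))) \in enum (Y (c x)).
      by rewrite mem_nth // E.
    by rewrite mem_enum inE => /eqP.
  by rewrite -E index_uniq ?enum_uniq // E.
exists f; split=> [|x]; last by have [] := fP x.
apply: inj_card_bij => [x x' eqf|].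
  have [t1 i1] := fP x; have [t2 i2] := fP x'.
  have cxx' : c x = c x' by rewrite -t1 -t2 eqf.
  move: i1; rewrite eqf cxx' i2 => /(congr1 (nth x (enum (X (c x'))))).
  by rewrite !nth_index // mem_enum inE ?cxx'.
rewrite -[#|T|]cardsT -[#|U|]cardsT !(card_ctype c) !(card_ctype t).
by apply/eq_leq/esym/eq_bigr => i _; rewrite eq_ct.
Qed.

Lemma card_color (d : nat) (n : {ffun 'I_d -> nat}) (i : 'I_d) (P : pred nat) :
  #|[set v : Kvertex n | (tag v == i) && P (tagged v)]| = count P (iota 0 (n i)).
Proof.
transitivity #|[set j : 'I_(n i) | P j]|.
  rewrite -(card_imset (f := Tagged (fun i => 'I_(n i))) [set j : 'I_(n i) | P j]); last first.
    by move=> j j'; apply: eq_from_Tagged.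
  apply: eq_card => v; rewrite inE; apply/andP/imsetP => [|[j Pj ->]].
    by case: v => i' j /= [/eqP ei]; subst i' => Pj; exists j; rewrite ?inE.
  by move: Pj; rewrite inE eqxx.
rewrite -val_enum_ord count_map cardE -size_filter.
by congr size; rewrite enumT; apply: eq_filter => j; rewrite !inE.
Qed.

Lemma count_itv (a b n : nat) : a <= b <= n ->
  count (fun j => a <= j < b) (iota 0 n) = b - a.
Proof.
move=> /andP[ab bn].
have -> : n = a + ((b - a) + (n - b)) by lia.
rewrite !iotaD !count_cat add0n subnKC //.
have -> : count (fun j => a <= j < b) (iota 0 a) = 0.
  by apply/eqP; rewrite -leqn0 leqNgt -has_count; apply/hasPn=> j; rewrite mem_iota; lia.
have -> : count (fun j => a <= j < b) (iota b (n - b)) = 0.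
  by apply/eqP; rewrite -leqn0 leqNgt -has_count; apply/hasPn=> j; rewrite mem_iota; lia.
rewrite addn0 add0n -[RHS](size_iota a); apply/eqP; rewrite -all_count.
by apply/allP=> j; rewrite mem_iota; lia.
Qed.

Lemma card_color_all (d : nat) (n : {ffun 'I_d -> nat}) (i : 'I_d) :
  #|[set v : Kvertex n | tag v == i]| = n i.
Proof.
have := card_color n i predT; rewrite count_predT size_iota => <-.
by apply: eq_card => v; rewrite !inE andbT.
Qed.

(** The bijection of a copy preserves color types, and membership in [K S r] depends on the type
    alone. Hence the vertex set determines the edges of the copy. *)
Lemma colored_copy_K (d : nat) (T : finType) (c : T -> 'I_d) (G : {set {set T}})
    (S : {fset {ffun 'I_d -> nat}}) (r : {ffun 'I_d -> nat}) (W : {set T})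
    (E : {set {set T}}) :
  colored_copy G c (K S r) (@Kcolor d r) W E ->
  ctype c W = r /\ forall e : {set T}, (e \in E) = (e \subset W) && (ctype c e \in S).
Proof.
case=> sEG sEW [f [bij_f fE cf]].
pose w := [eta val : {x | x \in W} -> T].
have inj_w : injective w by apply: val_inj.
have wK (e : {set T}) : e \subset W -> w @: [set x | w x \in e] = e.
  move=> seW; apply/setP=> x; apply/imsetP/idP => [[y + ->]|xe]; first by rewrite inE.
  by exists (Sub x (subsetP seW _ xe)); rewrite ?inE.
split=> [|e].
  rewrite -(wK W) // (ctype_imset (c := c \o w)) //.
  have -> : [set x | w x \in W] = setT by apply/setP=> x; rewrite !inE; apply: valP.
  rewrite -(ctype_imset (f := f) (t := @Kcolor d r)) //; last exact: bij_inj.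
  have -> : f @: setT = setT.
    by have [f' _ f'K] := bij_f; apply/setP=> y; rewrite inE -(f'K y) imset_f.
  by apply/ffunP=> i; rewrite ffunE setTI card_color_all.
have [seW|] := boolP (e \subset W); last by apply: contraNF => /sEW.
rewrite -[in LHS](wK e) // fE in_K (ctype_imset (c := c \o w)) //; last exact: bij_inj.
by rewrite -[in RHS](wK e) // (ctype_imset (c := c \o w)).
Qed.

Lemma colored_copy_K_exists (d : nat) (T : finType) (c : T -> 'I_d) (G : {set {set T}})
    (S : {fset {ffun 'I_d -> nat}}) (W : {set T}) :
  (forall e : {set T}, e \subset W -> ctype c e \in S -> e \in G) ->
  colored_copy G c (K S (ctype c W)) (@Kcolor d (ctype c W)) W
    [set e : {set T} | (e \subset W) && (ctype c e \in S)].
Proof.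
move=> GW; pose w := [eta val : {x | x \in W} -> T].
have inj_w : injective w by apply: val_inj.
have wT : w @: setT = W.
  apply/setP=> x; apply/imsetP/idP => [[y _ ->]|xW]; first exact: valP.
  by exists (Sub x xW).
have [f [bij_f cf]] : exists f : {x | x \in W} -> Kvertex (ctype c W),
    bijective f /\ forall x, c (w x) = Kcolor (f x).
  apply: (color_preserving_bijection (c := c \o w)).
  rewrite -(ctype_imset (f := w) (t := c)) // wT.
  by apply/ffunP=> i; rewrite [RHS]ffunE setTI card_color_all.
split=> [|e|].
- by apply/subsetP=> e; rewrite inE => /andP[]; apply: GW.
- by rewrite inE => /andP[].
exists f; split=> // A; rewrite in_K inE.
rewrite (ctype_imset (f := f) (c := c \o w)) //; last exact: bij_inj.
rewrite (ctype_imset (f := w) (c := c \o w)) //.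
suff -> : w @: A \subset W by [].
by apply/subsetP=> _ /imsetP[x _ ->]; apply: valP.
Qed.

(** * Lower bound *)

Import GRing.Theory Num.Theory.

(** The matrix is lower triangular with nonzero diagonal, so it has rank [k]; it also factors
    through a space of dimension [#|A|]. *)
Lemma triangular_factorization_bound (R : fieldType) (k : nat) (J : finType)
    (A : {set J}) (M : 'I_k -> 'I_k -> R) (a : 'I_k -> J -> R) (b : J -> 'I_k -> R) :
  (forall i j, M i j = \sum_(x in A) a i x * b x j)%R ->
  (forall i, M i i != 0)%R -> (forall i j : 'I_k, (i < j)%N -> M i j = 0)%R ->
  k <= #|A|.
Proof.
move=> defM diagM trigM.
pose Mm := (\matrix_(i, j) M i j)%R.
have unitM : Mm \in unitmx.
  rewrite unitmxE det_trig; last by apply/is_trig_mxP=> i j lt_ij; rewrite mxE trigM.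
  by rewrite unitfE; apply/prodf_neq0=> i _; rewrite mxE.
have MmE : Mm = (\matrix_(i < k, x < #|A|) a i (enum_val x) *m
                 \matrix_(x < #|A|, j < k) b (enum_val x) j)%R.
  apply/matrixP=> i j; rewrite !mxE defM big_enum_val.
  by apply: eq_bigr => x _; rewrite !mxE.
rewrite -[X in X <= _](mxrank_unit unitM) MmE.
exact: leq_trans (mxrankM_maxl _ _) (rank_leq_col _).
Qed.

Lemma big_option (R : Type) (idx : R) (op : Monoid.com_law idx) (T : finType)
    (F : option T -> R) :
  \big[op/idx]_o F o = op (F None) (\big[op/idx]_v F (Some v)).
Proof.
rewrite (bigD1 None) //= (reindex_omap Some id); last by case.
by congr (op _ _); apply: eq_bigl => v; rewrite eqxx.
Qed.

Lemma big_color (R : Type) (idx : R) (op : Monoid.com_law idx) (d : nat)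
    (n : {ffun 'I_d -> nat}) (i : 'I_d) (F : nat -> R) :
  \big[op/idx]_(v : Kvertex n | tag v == i) F (tagged v) = \big[op/idx]_(j < n i) F j.
Proof.
transitivity (\big[op/idx]_(i' | i' == i) \big[op/idx]_(j < n i') F j).
  rewrite sig_big_dep /=.
  by apply: eq_bigl => v; rewrite andbT.
by rewrite big_pred1_eq.
Qed.

(** An exponent vector splits into its restrictions to the colors, extended by zero; stars and bars
    bounds the choices in each color. *)
Lemma card_exponents (d : nat) (T : finType) (c : T -> 'I_d) (b : nat) (m : 'I_d -> nat) :
  #|[set k : {ffun T -> 'I_b.+1} | [forall i, \sum_(x | c x == i) k x == m i]]|
  <= \prod_i 'C(m i - 1 + #|[set x | c x == i]|, m i).
Proof.
pose X i := [set x | c x == i].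
pose F i := [set k : {ffun T -> 'I_b.+1} | [forall x, (x \notin X i) ==> (k x == 0 :> nat)]
      && (\sum_(x in X i) k x == m i)].
apply: (@leq_trans (\prod_i #|F i|)); last first.
  by apply: leq_prod => i _; apply: card_ffun_supp_sum.
rewrite -card_family_prod.
pose g (k : {ffun T -> 'I_b.+1}) := [ffun i => [ffun x => if c x == i then k x else ord0]].
rewrite -(card_imset _ (f := g)); last first.
  move=> k k' /ffunP eqk; apply/ffunP=> x.
  by have /ffunP/(_ x) := eqk (c x); rewrite !ffunE eqxx.
apply: subset_leq_card; apply/subsetP=> _ /imsetP[k + ->]; rewrite inE => /forallP mk.
apply/familyP=> i; rewrite ffunE inE; apply/andP; split.
  by apply/forallP=> x; apply/implyP; rewrite inE ffunE => /negPf->.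
rewrite -(eqP (mk i)); apply/eqP; apply: eq_big => x; rewrite inE // => cx.
by rewrite ffunE cx.
Qed.

Local Open Scope ring_scope.

(** * The polynomials of a copy and their expansion in coefficients *)

Definition vpoly (d : nat) (n : {ffun 'I_d -> nat}) (W : {set Kvertex n}) (i : 'I_d) :
    {poly rat} :=
  \prod_(v | (v \notin W) && (tag v == i)) ('X - ((tagged v : nat)%:R)%:P).

Lemma vpoly_monic (d : nat) (n : {ffun 'I_d -> nat}) (W : {set Kvertex n}) (i : 'I_d) :
  vpoly W i \is monic.
Proof. exact: monic_prod_XsubC. Qed.

(** The degree depends on [W] only through its color type, so all copies of [K S r] share the same
    coefficient variables. *)
Lemma size_vpoly (d : nat) (n : {ffun 'I_d -> nat}) (W : {set Kvertex n}) (i : 'I_d) :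
  size (vpoly W i) = (n i - ctype (@Kcolor d n) W i).+1.
Proof.
rewrite /vpoly -big_filter size_prod_XsubC size_filter; congr _.+1.
rewrite ffunE -(card_color_all n i) -(cardsID W [set v | tag v == i]) setIC addKn.
rewrite cardE -size_filter /enum_mem; congr size.
by apply: eq_filter => v; rewrite !inE.
Qed.

Definition eval_edge (d : nat) (n : {ffun 'I_d -> nat}) (W e : {set Kvertex n}) : rat :=
  \prod_(u in e) (vpoly W (tag u)).[(tagged u : nat)%:R].

(** Distinct vertices of one color have distinct coordinates in [rat], so the factor of [u] vanishes
    exactly when [u] is itself outside [W]. *)
Lemma eval_edge_eq0 (d : nat) (n : {ffun 'I_d -> nat}) (W e : {set Kvertex n}) :
  (eval_edge W e == 0) = ~~ (e \subset W).
Proof.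
apply/idP/subsetPn => [/prodf_eq0[u ue] | [u ue uW]]; last first.
  apply/prodf_eq0; exists u => //.
  by rewrite /vpoly (bigD1 u) /= ?uW ?eqxx // hornerM hornerXsubC subrr mul0r.
rewrite horner_prod => /prodf_eq0[v /andP[vW /eqP tv]].
rewrite hornerXsubC subr_eq0 eqr_nat => uv; exists u => //.
suff -> : u = v by [].
case: u v {ue vW} tv uv => [i j] [i' j'] /= ei; subst i' => /eqP eqj.
by rewrite (val_inj eqj).
Qed.

Section Expansion.
Variables (d : nat) (n N : {ffun 'I_d -> nat}).
Implicit Types (W e : {set Kvertex n}) (u : Kvertex n) (g : {ffun Kvertex n -> option (Kvertex N)}).

(** The vertex (j, i) of [Kvertex N] stands for the coefficient of degree j in the polynomial of
    color i; [None] stands for the leading coefficient 1. *)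
Definition vcoef W (o : option (Kvertex N)) : rat :=
  if o is Some v then (vpoly W (tag v))`_(tagged v) else 1.

(* [None] stands for the leading monomial of [vpoly W (tag u)].  A vertex outside
   [e] contributes the factor 1 through [None], so that products over [e] become
   products over all vertices and distribute over functions defined on them. *)
Definition point_power e u (o : option (Kvertex N)) : rat :=
  if u \in e then
    if o is Some v then
      if tag v == tag u then (tagged u)%:R ^+ (tagged v) else 0
    else (tagged u)%:R ^+ N (tag u)
  else (o == None)%:R.

(** The exponents of the monomial picked by [g]. Each vertex picks at most one coefficient, so the
    cap [#|Kvertex n|] loses nothing and makes the exponent vectors a finite type. *)
Definition exponent g : {ffun Kvertex N -> 'I_#|Kvertex n|.+1} :=
  [ffun v => inord #|[set u | g u == Some v]|].

Lemma exponentE g v : exponent g v = #|[set u | g u == Some v]| :> nat.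
Proof. by rewrite ffunE inordK // ltnS max_card. Qed.

Lemma sum_vcoef W e u :
  (forall i, size (vpoly W i) = (N i).+1) ->
  \sum_o vcoef W o * point_power e u o =
  if u \in e then (vpoly W (tag u)).[(tagged u : nat)%:R] else 1.
Proof.
move=> sizeW; rewrite big_option /point_power; case: ifP => [ue|_]; last first.
  rewrite big1 ?addr0 ?mul1r ?eqxx // => v _; by rewrite mulr0.
rewrite (horner_coef_wide _ (n := (N (tag u)).+1)) ?sizeW // big_ord_recr /= addrC.
congr (_ + _); last first.
  have /monicP := vpoly_monic W (tag u); rewrite lead_coefE sizeW /= => ->.
  by [].
rewrite -(@big_color _ _ _ _ N (tag u) (fun j => (vpoly W (tag u))`_j * (tagged u)%:R ^+ j)).
rewrite [RHS]big_mkcond; apply: eq_bigr => v _ /=.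
by case: eqP => [tv|_]; [congr ((vpoly W _)`__ * _) | rewrite mulr0].
Qed.

Lemma prod_vcoef W g :
  \prod_u vcoef W (g u) = \prod_v vcoef W (Some v) ^+ exponent g v.
Proof.
rewrite (partition_big g predT) //= big_option /= big1 ?mul1r => [|u /eqP-> //].
apply: eq_bigr => v _; rewrite exponentE (eq_bigr (fun _ => vcoef W (Some v))).
  by rewrite prodr_const; congr (_ ^+ _); apply: eq_card => u; rewrite !inE.
by move=> u /eqP->.
Qed.

(** In a nonzero term, a vertex of [e] picks a coefficient of its own color or the leading term, and
    every other vertex picks [None]. The leading terms make the degree drop, which is why the whole
    down-set occurs. *)
Lemma exponent_degree e g i :
  \prod_u point_power e u (g u) != 0 ->
  (\sum_(v | tag v == i) exponent g v <= ctype (@Kcolor d n) e i)%N.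
Proof.
move=> /prodf_neq0 nz; rewrite ffunE.
under eq_bigr do rewrite exponentE -sum1_card.
rewrite (exchange_big_dep predT) //= -sum1_card [X in (_ <= X)%N]big_mkcond /=.
apply: leq_sum => u _; rewrite sum1_card.
have nzu := nz u isT; rewrite /point_power in nzu.
have [u_i|u_i] := boolP (u \in _).
  apply/card_le1_eqP => v v' /andP[_ gv] /andP[_ gv'].
  by move: gv gv'; rewrite !inE => /eqP-> /eqP[].
rewrite leqn0; apply/eqP/eq_card0 => v; apply/andP=> -[/eqP tv]; rewrite inE => /eqP gv.
move: u_i nzu; rewrite !inE gv.
by case: (u \in e) => //=; rewrite ?eqxx // /Kcolor -tv eq_sym => /negPf->; rewrite eqxx.
Qed.

(** Distribute the product over choices [g] and collect those with equal exponents. One factor then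
    depends on [W] only and the other on [e] only, as [triangular_factorization_bound] requires. *)
Lemma eval_edge_expansion (D : {fset {ffun 'I_d -> nat}}) W e :
  (forall i, size (vpoly W i) = (N i).+1) ->
  (forall m : {ffun 'I_d -> nat},
     (forall i, (m i <= ctype (@Kcolor d n) e i)%N) -> m \in D) ->
  eval_edge W e =
  \sum_(k in [set k : {ffun Kvertex N -> 'I_#|Kvertex n|.+1} |
              [ffun i => \sum_(v | tag v == i) (k v : nat)]%N \in D])
    (\prod_v vcoef W (Some v) ^+ k v) *
    (\sum_(g : {ffun Kvertex n -> option (Kvertex N)} |
         (\prod_u point_power e u (g u) != 0) && (exponent g == k))
       \prod_u point_power e u (g u)).
Proof.
move=> sizeW eD.
rewrite /eval_edge big_mkcond /= (eq_bigr _ (fun u _ => esym (sum_vcoef e u sizeW))).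
rewrite bigA_distr_bigA /=.
(* Zero terms go first: only for nonzero ones are the degrees of the exponent known to lie in
   [D]. *)
rewrite (bigID (fun g : {ffun Kvertex n -> option (Kvertex N)} =>
  \prod_u point_power e u (g u) != 0)) /=.
rewrite [X in _ + X]big1 ?addr0; last first.
  by move=> g; rewrite negbK big_split => /eqP-> /=; rewrite mulr0.
rewrite (partition_big exponent (mem [set k : {ffun Kvertex N -> 'I_#|Kvertex n|.+1} |
              [ffun i => \sum_(v | tag v == i) (k v : nat)]%N \in D])) /=; last first.
  move=> g nz; rewrite inE; apply: eD => i; rewrite ffunE.
  exact: exponent_degree.
apply: eq_bigr => k _; rewrite mulr_sumr; apply: eq_bigr => g /andP[_ /eqP <-].
by rewrite big_split prod_vcoef.
Qed.

End Expansion.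

Local Close Scope ring_scope.

Lemma weakly_saturated_missing_leq (d : nat) (r n : {ffun 'I_d -> nat})
    (S : {fset {ffun 'I_d -> nat}}) (F : {set {set Kvertex n}}) :
  weakly_saturated (K S n) (@Kcolor d n) (K S r) (@Kcolor d r) F ->
  #|K S n :\: F| <= \sum_(m <- downset S) \prod_(i < d) 'C(m i - 1 + (n i - r i), m i).
Proof.
case=> _ [es [uniq_es esE satF]].
have <- : size es = #|K S n :\: F| by rewrite -(card_uniqP uniq_es); apply: eq_card.
pose N := [ffun i => n i - r i] : {ffun 'I_d -> nat}.
(* [W i] carries the copy used at step [i]: all edges of [K S n] inside it are present after that
   step. *)
have /fin_all_exists[W WP] (i : 'I_(size es)) : exists W : {set Kvertex n},
    [/\ ctype (@Kcolor d n) W = r, nth set0 es i \subset W &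
        forall e : {set Kvertex n}, e \in K S n -> e \subset W ->
          e \in F :|: [set:: take i.+1 es]].
  have [W [E [copyE iE]]] := satF i (ltn_ord i).
  have [ctW EE] := colored_copy_K copyE.
  exists W; split=> // [|e eK eW]; first by move: iE; rewrite EE => /andP[].
  by have [/subsetP sE _ _] := copyE; apply: sE; rewrite EE eW -in_K.
have es_K (j : 'I_(size es)) : (nth set0 es j \in K S n) && (nth set0 es j \notin F).
  by have := mem_nth set0 (ltn_ord j); rewrite esE inE andbC.
have sizeW i j : size (vpoly (W i) j) = (N j).+1.
  by have [ctW _ _] := WP i; rewrite size_vpoly ctW ffunE.
set D := downset S.
have expand i j := eval_edge_expansion (D := D) (W := W i) (e := nth set0 es j) (sizeW i).
apply: leq_trans (triangular_factorization_bound
  (M := fun i j => eval_edge (W i) (nth set0 es j)) (fun i j => expand i j _) _ _) _.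
- move=> _ j m le_m; apply/downsetP.
  exists (ctype (@Kcolor d n) (nth set0 es j)) => //.
  by rewrite -in_K; case/andP: (es_K j).
- by move=> i; rewrite eval_edge_eq0 negbK; have [] := WP i.
(* An edge added after step [i] cannot lie inside [W i], since it would already be present. *)
- move=> i j lt_ij; apply/eqP; rewrite eval_edge_eq0; apply/negP=> sub_jW.
  have [eK eF] := andP (es_K j).
  have [_ _ /(_ _ eK sub_jW)] := WP i.
  rewrite !inE (negPf eF) /= in_take ?mem_nth // index_uniq // ltnS.
  by rewrite leqNgt lt_ij.
(* Sort the monomials by their vector [m] of degrees in the colors. *)
rewrite card_preim_seq ?fset_uniq //; apply: leq_sum => m _.
apply: leq_trans (leq_trans _ (card_exponents (@Kcolor d N) #|Kvertex n| m)) _.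
  apply/subset_leq_card/subsetP=> k; rewrite !inE => /eqP/ffunP mE.
  by apply/forallP=> i; rewrite -mE ffunE.
by apply/eq_leq/eq_bigr => i _; rewrite card_color_all ffunE.
Qed.

(** * Upper bound *)

Definition core_itv {d : nat} {n : {ffun 'I_d -> nat}} (a b : 'I_d -> nat) :
    {set Kvertex n} := [set v : Kvertex n | a (tag v) <= tagged v < b (tag v)].

Lemma ctype_core_itv (d : nat) (n : {ffun 'I_d -> nat}) (a b : 'I_d -> nat) (i : 'I_d) :
  a i <= b i <= n i -> ctype (@Kcolor d n) (core_itv a b) i = b i - a i.
Proof.
move=> abn; rewrite ffunE -(count_itv abn) -card_color.
apply: eq_card => v; rewrite !inE /Kcolor andbC.
by case: eqP => // <-.
Qed.

(** Sort [I] by [level], with ties in any order. When [phi A] is added, every [phi B] of smaller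
    level precedes it. *)
Lemma weakly_saturated_by_level (d : nat) (T U : finType) (G : {set {set T}})
    (c : T -> 'I_d) (H : {set {set U}}) (t : U -> 'I_d) (J : finType) (I : {set J})
    (phi : J -> {set T}) (level : J -> nat) :
  {in I &, injective phi} -> phi @: I \subset G ->
  (forall (A : J) (G' : {set {set T}}), A \in I ->
     G :\: phi @: I \subset G' -> phi A \in G' ->
     (forall B, B \in I -> level B < level A -> phi B \in G') ->
     exists W E, colored_copy G' c H t W E /\ phi A \in E) ->
  weakly_saturated G c H t (G :\: phi @: I).
Proof.
move=> inj_phi sub_phi copy_phi; split; first exact: subsetDl.
pose le_lvl A B := level A <= level B.
pose s := sort le_lvl (enum I).
have s_sorted : sorted le_lvl s by apply: sort_sorted => A B; apply: leq_total.
have mem_s A : (A \in s) = (A \in I) by rewrite mem_sort mem_enum.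
exists (map phi s); split.
- rewrite map_inj_in_uniq ?sort_uniq ?enum_uniq // => A B; rewrite !mem_s.
  exact: inj_phi.
- move=> e; rewrite setDDr setDv set0U (setIidPr sub_phi).
  apply/mapP/imsetP => -[A AI ->]; exists A => //; first by rewrite -mem_s.
  by rewrite mem_s.
move=> i; rewrite size_map => lt_i.
have [A0 _] : exists A0 : J, true by move: lt_i; case: (s) => // A0; exists A0.
rewrite (nth_map A0) //; apply: copy_phi.
- by rewrite -mem_s mem_nth.
- exact: subsetUl.
- rewrite !inE; apply/orP; right; rewrite -map_take map_f // (take_nth A0) //.
  by rewrite mem_rcons mem_head.
move=> B; rewrite -mem_s => Bs lt_B; rewrite !inE; apply/orP; right.
rewrite -map_take map_f // in_take // ltnS leqNgt; apply/negP=> lt_ij.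
have lt_j : index B s < size s by rewrite index_mem.
have := sorted_leq_nth (leT := le_lvl) (fun _ _ _ => @leq_trans _ _ _)
  (fun _ => leqnn _) A0 s_sorted _ _ lt_i lt_j (ltnW lt_ij).
by rewrite /le_lvl nth_index // leqNgt lt_B.
Qed.

Lemma card_K (d : nat) (n : {ffun 'I_d -> nat}) (S : {fset {ffun 'I_d -> nat}}) :
  #|K S n| = \sum_(s <- S) \prod_(i < d) 'C(n i, s i).
Proof.
transitivity #|[set A | ctype (@Kcolor d n) A \in S]|.
  by apply: eq_card => A; rewrite in_K inE.
rewrite card_preim_seq ?fset_uniq //; apply: eq_bigr => s _.
transitivity #|[set A : {set Kvertex n} | (A \subset [set: Kvertex n]) &&
    [forall i, #|A :&: [set x | Kcolor x == i]| == s i]]|.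
  apply: eq_card => A; rewrite !inE subsetT; apply/eqP/forallP => [<- i|As].
    by rewrite ffunE.
  by apply/ffunP=> i; rewrite ffunE; apply/eqP/As.
rewrite card_sets_by_fiber; apply: eq_bigr => i _.
by rewrite setTI card_color_all.
Qed.

(* For m = ctype A, color i leaves n_i - (r_i - m_i + 1) places for m_i points,
   which matches the number of monomials of degree m_i in n_i - r_i variables. *)
Definition free_sets {d : nat} {n : {ffun 'I_d -> nat}} (r : {ffun 'I_d -> nat})
    (D : {fset {ffun 'I_d -> nat}}) : {set {set Kvertex n}} :=
  [set A | (ctype (@Kcolor d n) A \in D) &&
           (A \subset core_itv (fun i => (r i - ctype (@Kcolor d n) A i).+1) n)].

Lemma card_free_sets_type (d : nat) (r n m : {ffun 'I_d -> nat}) :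
  (forall i, m i <= r i <= n i) ->
  #|[set A : {set Kvertex n} | (ctype (@Kcolor d n) A == m) &&
      (A \subset core_itv (fun i => (r i - ctype (@Kcolor d n) A i).+1) n)]|
  = \prod_(i < d) 'C(m i - 1 + (n i - r i), m i).
Proof.
move=> mrn; pose B := core_itv (n := n) (fun i => (r i - m i).+1) n.
transitivity #|[set A : {set Kvertex n} | (A \subset B) &&
    [forall i, #|A :&: [set x | Kcolor x == i]| == m i]]|.
  apply: eq_card => A; rewrite !inE andbC.
  have -> : [forall i, #|A :&: [set x | Kcolor x == i]| == m i] =
            (ctype (@Kcolor d n) A == m).
    apply/forallP/eqP => [Am|<- i]; last by rewrite ffunE.
    by apply/ffunP=> i; rewrite ffunE; apply/eqP/Am.
  by apply: andb_id2r => /eqP->.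
rewrite card_sets_by_fiber; apply: eq_bigr => i _.
(* For [m i = 0] the interval would start at [r i + 1], possibly beyond [n i], but both binomials
   are 1. *)
have [-> | m0] := posnP (m i); first by rewrite !bin0.
have mrni := mrn i.
have := @ctype_core_itv d n (fun i => (r i - m i).+1) n i.
rewrite ffunE -/B /= => ->; last by lia.
by congr 'C(_, _); lia.
Qed.

Lemma card_free_sets (d : nat) (r n : {ffun 'I_d -> nat}) (D : {fset {ffun 'I_d -> nat}}) :
  (forall m : {ffun 'I_d -> nat}, m \in D -> forall i, m i <= r i) ->
  (forall i, r i <= n i) ->
  #|free_sets (n := n) r D| = \sum_(m <- D) \prod_(i < d) 'C(m i - 1 + (n i - r i), m i).
Proof.
move=> mr rn; rewrite card_preim_seq_in ?fset_uniq //.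
rewrite big_seq [RHS]big_seq; apply: eq_bigr => m mD.
by apply: card_free_sets_type => i; rewrite mr ?rn.
Qed.

(** A count in each color shows that the type of [B] is at most that of [A]. If [B] is not smaller,
    the types agree; then [B] avoids the added interval, hence lies in [A] and equals it. *)
Lemma free_set_leq (d : nat) (r n : {ffun 'I_d -> nat}) (D : {fset {ffun 'I_d -> nat}})
    (A B : {set Kvertex n}) :
  (forall m : {ffun 'I_d -> nat}, m \in D -> forall i, m i <= r i) -> (forall i, r i <= n i) ->
  A \in free_sets r D -> B \in free_sets r D ->
  B \subset A :|: core_itv (fun=> 0) (fun i => r i - ctype (@Kcolor d n) A i) ->
  B = A \/ #|B| < #|A|.
Proof.
move=> mr rn; rewrite !inE => /andP[/mr Ar /subsetP A_itv] /andP[/mr Br /subsetP B_itv] /subsetP BA.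
set a := ctype _ A in Ar A_itv BA *; set b := ctype _ B in Br B_itv.
have le_ba i : b i <= a i.
  rewrite leqNgt; apply/negP=> lt_ab.
  (* If [a i < b i], the points of [B] of color [i] lie in [A] or have index from [r i - b i + 1] up
     to below [r i - a i]: at most [a i + (b i - a i - 1)] points. The [.+1] in [free_sets] yields
     the missing unit. *)
  have : b i <= #|(A :&: [set x | Kcolor x == i]) :|:
                  (core_itv (fun i => (r i - b i).+1) (fun i => r i - a i)
                   :&: [set x | Kcolor x == i])|.
    rewrite /b ffunE; apply/subset_leq_card/subsetP=> x; rewrite !inE => /andP[xB xi].
    have := BA _ xB; have := B_itv _ xB; rewrite !inE xi !andbT.
    by case/andP=> -> _ /orP[-> //|->]; rewrite orbT.
  have Ari := Ar i; have Bri := Br i; have rni := rn i.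
  have eqc : ctype (@Kcolor d n) (core_itv (fun i => (r i - b i).+1) (fun i => r i - a i)) i
      = (r i - a i) - (r i - b i).+1 by rewrite ctype_core_itv //; lia.
  move=> /leq_trans/(_ (leq_card_setU _ _)).
  have -> : #|A :&: [set x | Kcolor x == i]| = a i by rewrite /a ffunE.
  rewrite [ctype _ _ _]ffunE in eqc; rewrite eqc; lia.
have [|le_AB] := ltnP #|B| #|A|; [by right | left].
have eq_ab i : b i = a i.
  apply/eqP; rewrite eqn_leq le_ba /= leqNgt; apply/negP=> lt_ba.
  move: le_AB; rewrite leqNgt => /negP; apply.
  rewrite !(card_ctype (@Kcolor d n)) (bigD1 i) //= [X in _ < X](bigD1 i) //=.
  by rewrite -addSn leq_add // leq_sum.
apply/eqP; rewrite eqEcard le_AB andbT; apply/subsetP=> x xB.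
have := BA _ xB; have := B_itv _ xB; rewrite !inE eq_ab => /andP[lt_x _].
by rewrite leq0n /= ltnNge ltnW // orbF.
Qed.

Lemma weakly_saturated_exists (d : nat) (r n : {ffun 'I_d -> nat})
    (S : {fset {ffun 'I_d -> nat}}) :
  (forall s : {ffun 'I_d -> nat}, s \in S -> forall i, s i <= r i) -> (forall i, r i <= n i) ->
  exists2 M : {set {set Kvertex n}}, M \subset K S n &
    weakly_saturated (K S n) (@Kcolor d n) (K S r) (@Kcolor d r) (K S n :\: M) /\
    #|M| = \sum_(m <- downset S) \prod_(i < d) 'C(m i - 1 + (n i - r i), m i).
Proof.
move=> sr rn; pose D := downset S; pose ct := ctype (@Kcolor d n).
have mr (m : {ffun 'I_d -> nat}) : m \in D -> forall i, m i <= r i.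
  by move=> /downsetP[s sS le_ms] i; apply: leq_trans (le_ms i) (sr _ sS i).
have /fin_all_exists[s sP] (A : {set Kvertex n}) : exists s : {ffun 'I_d -> nat},
    A \in free_sets r D -> s \in S /\ forall i, ct A i <= s i.
  have [|nA] := boolP (A \in free_sets r D); last by exists r.
  by rewrite inE => /andP[/downsetP[s sS le_As] _]; exists s.
(* The initial interval completes the type of [A] to [r] in [W A], and its final segment completes
   it to [s A] in [phi A]. *)
pose W A := A :|: core_itv (fun=> 0) (fun i => r i - ct A i).
pose phi A := A :|: core_itv (fun i => r i - s A i) (fun i => r i - ct A i).
have disjA A a : A \in free_sets r D -> [disjoint A & core_itv a (fun i => r i - ct A i)].
  rewrite inE => /andP[_ /subsetP A_itv]; apply/pred0P=> x /=; apply/negP=> /andP[xA].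
  by have := A_itv _ xA; rewrite !inE /ct => /andP[lt1 _] /andP[_ lt2]; lia.
have ctW A : A \in free_sets r D -> ct (W A) = r.
  move=> AI; have := AI; rewrite inE => /andP[/mr Ar _].
  suff E i : ct (W A) i = r i by apply/ffunP.
  have Ari : ct A i <= r i := Ar i; have rni := rn i.
  by rewrite [LHS]ctypeU ?disjA // ctype_core_itv -/(ct A); lia.
have ct_phi A : A \in free_sets r D -> ct (phi A) = s A.
  move=> AI; have [sS le_As] := sP _ AI.
  suff E i : ct (phi A) i = s A i by apply/ffunP.
  have sAri := sr _ sS i; have rni := rn i; have le_Asi := le_As i.
  by rewrite [LHS]ctypeU ?disjA // ctype_core_itv -/(ct A); lia.
have sub_phi A : phi A \subset W A.
  by apply: setUS; apply/subsetP=> x; rewrite !inE => /andP[].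
have phi_leq A B : A \in free_sets r D -> B \in free_sets r D -> phi B \subset W A ->
    B = A \/ #|B| < #|A|.
  move=> AI BI sBA; apply: (free_set_leq mr rn AI BI).
  exact: subset_trans (subsetUl _ _) sBA.
(* If [phi A = phi B], each of the two sets fits the other's copy, and distinct sets would be
   strictly smaller than each other. *)
have inj_phi : {in free_sets r D &, injective phi}.
  move=> A B AI BI eq_phi.
  have [|//|lt1] := phi_leq A B AI BI; first by rewrite -eq_phi.
  have [|//|lt2] := phi_leq B A BI AI; first by rewrite eq_phi.
  by move: (ltn_trans lt1 lt2); rewrite ltnn.
have phiK : phi @: free_sets r D \subset K S n.
  apply/subsetP=> _ /imsetP[A AI ->]; rewrite in_K -/ct ct_phi //.
  by have [] := sP _ AI.
exists (phi @: free_sets r D) => //; split; last first.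
  by rewrite card_in_imset // (card_free_sets mr rn).
apply: (weakly_saturated_by_level (phi := phi) (level := fun A : {set Kvertex n} => #|A|))
  => // A G' AI sub_G' phiA lt_G'.
have := @colored_copy_K_exists d _ (@Kcolor d n) G' S (W A).
rewrite -/ct (ctW A AI) => copy.
exists (W A), [set e : {set Kvertex n} | (e \subset W A) && (ct e \in S)].
split; last by rewrite inE sub_phi ct_phi //; have [] := sP _ AI.
apply: copy => e eW eS.
(* An edge inside [W A] was kept, or is [phi B] with [B = A] or [#|B| < #|A|], hence is already
   restored. *)
have [/imsetP[B BI eB]|e_phi] := boolP (e \in phi @: free_sets r D); last first.
  by apply: (subsetP sub_G'); rewrite inE e_phi in_K.
rewrite eB; rewrite eB in eW; have [-> //|lt_BA] := phi_leq A B AI BI eW.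
exact: lt_G'.
Qed.

Theorem theorem1p2 (d : nat) (r n : {ffun 'I_d -> nat})
    (S : {fset {ffun 'I_d -> nat}}) (hd : 1 <= d) (hS : S != fset0)
    (hrn : forall s : {ffun 'I_d -> nat}, s \in S ->
           forall i : 'I_d, s i <= r i /\ r i <= n i) :
  ((cwsat (K S n) (@Kcolor d n) (K S r) (@Kcolor d r))%:Z =
    (\sum_(s <- S) \prod_(i < d) 'C(n i, s i))%N%:Z -
    (\sum_(m <- downset S)
       \prod_(i < d | m i != 0) 'C(m i - 1 + n i - r i, m i))%N%:Z)%R.
Proof.
have sr (s : {ffun 'I_d -> nat}) : s \in S -> forall i, s i <= r i.
  by move=> sS i; have [] := hrn s sS i.
have [s0 s0S] := fset0Pn _ hS.
have rn i : r i <= n i by have [] := hrn _ s0S i.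
(* Factors with [m i = 0] are 1, and [r i <= n i] allows regrouping the truncated subtraction. *)
have -> : \sum_(m <- downset S) \prod_(i < d | m i != 0) 'C(m i - 1 + n i - r i, m i) =
          \sum_(m <- downset S) \prod_(i < d) 'C(m i - 1 + (n i - r i), m i).
  apply: eq_bigr => m _; rewrite big_mkcond; apply: eq_bigr => i _ /=.
  by case: eqP => [->|_]; rewrite ?bin0 ?addnBA.
rewrite -card_K; set D := \sum_(m <- _) _.
have [[F satF cardF] minF] := cwsatP (K S n) (@Kcolor d n) (K S r) (@Kcolor d r).
have [sFK _] := satF.
(* A minimum [F] misses at most [D] edges, and some weakly saturated set misses exactly [D]; the
   inclusions in [K S n] make the subtractions exact. *)
have := weakly_saturated_missing_leq satF; rewrite -/D cardsD (setIidPr sFK) cardF.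
have [M sMK [/minF + cardM]] := weakly_saturated_exists sr rn.
have := subset_leq_card sFK; have := subset_leq_card sMK; rewrite cardF.
rewrite cardsD (setIidPr sMK) cardM -/D; lia.
Qed.
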